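(* Let $A\subset\mathbf{Z}_{\geq0}$ be finite with $0\in A$, $N=\#A\geq 2$, and $\Omega=A+[0,1)$. Suppose $\Omega\subset[0,M]$ for some $M<5N/2$, and that $\Lambda$ is a spectrum for $\Omega$ with $0\in\Lambda$. Then $\Lambda\subset\mathbf{Q}$.
   Context: A set $\Lambda\subset\mathbf{R}$ is a spectrum for $\Omega$ if $\{e^{2\pi i\lambda x}\}_{\lambda\in\Lambda}$ is an orthogonal basis of $L^2(\Omega)$. *)

(* Defs.v *)
From HB Require Import structures.
From mathcomp Require Import all_boot all_order all_algebra.
From mathcomp Require Import all_classical all_reals all_analysis.
Set Implicit Arguments. Unset Strict Implicit. Unset Printing Implicit Defensive.
Import Order.TTheory GRing.Theory Num.Theory.
Import numFieldNormedType.Exports.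
Local Open Scope classical_set_scope.
Local Open Scope ring_scope.

(* Omega = A + [0,1), for a finite set A of nonnegative integers,
   represented as a duplicate-free list of naturals. *)
Definition Omega {R : realType} (A : seq nat) : set R :=
  [set x | exists2 a : nat, a \in A & (a%:R <= x) /\ (x < a%:R + 1)].

Definition L2 {R : realType} (D : set R) (u : R -> R) : Prop :=
  measurable_fun D u /\
  (@lebesgue_measure R).-integrable D (fun x => ((u x) ^+ 2)%:E).

(* Real and imaginary parts of the L^2(D) inner product
   < u + i v , e_l > = \int_D (u + i v)(x) e^{-2 pi i l x} dx. *)
Definition ip_re {R : realType} (D : set R) (u v : R -> R) (l : R) : R :=
  Rintegral (@lebesgue_measure R) D
    (fun x => u x * cos (2 * pi * l * x) + v x * sin (2 * pi * l * x)).
Definition ip_im {R : realType} (D : set R) (u v : R -> R) (l : R) : R :=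
  Rintegral (@lebesgue_measure R) D
    (fun x => v x * cos (2 * pi * l * x) - u x * sin (2 * pi * l * x)).

(* Lambda is a spectrum for D: the exponentials e_l(x) = e^{2 pi i l x},
   l in Lambda, form an orthogonal basis of L^2(D), i.e. they are pairwise
   orthogonal (<e_l, e_m> = \int_D e^{2 pi i (l - m) x} dx = 0 for l <> m)
   and complete (the only f in L^2(D) orthogonal to all of them is 0 a.e.). *)
Definition spectrum {R : realType} (D : set R) (Lambda : set R) : Prop :=
  (forall l m, Lambda l -> Lambda m -> l <> m ->
     Rintegral (@lebesgue_measure R) D (fun x => cos (2 * pi * (l - m) * x)) = 0
     /\ Rintegral (@lebesgue_measure R) D (fun x => sin (2 * pi * (l - m) * x)) = 0)
  /\
  (forall u v : R -> R, L2 D u -> L2 D v ->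
     (forall l, Lambda l -> ip_re D u v l = 0 /\ ip_im D u v l = 0) ->
     {ae (@lebesgue_measure R), forall x, D x -> u x = 0 /\ v x = 0}).

(* Main.v *)
Require Import Defs.
From HB Require Import structures.
From mathcomp Require Import all_boot all_order all_algebra all_field.
From mathcomp Require Import complex.
From mathcomp Require Import all_classical all_reals all_analysis.
From mathcomp Require Import measurable_realfun zify ring lra.
Set Implicit Arguments. Unset Strict Implicit. Unset Printing Implicit Defensive.
Import Order.TTheory GRing.Theory Num.Theory.
Import numFieldNormedType.Exports.
Local Open Scope classical_set_scope.
Local Open Scope ring_scope.
Local Open Scope complex_scope.

(** Write [z = exp (2 i pi l)] for the frequencies [l]. A step function constant
    on the unit cells of [Omega A] can be made orthogonal to all exponentials if
    there are fewer than [N = size A] frequencies modulo 1, so a spectrum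
    provides [N] distinct unimodular numbers, including 1 and the one under
    study, whose pairwise quotients are roots of [F = \sum_(a in A) 'X^a].
    If one of them were not a root of unity, Kronecker's theorem would give a
    conjugation sending it off the unit circle; the images have at least two
    distinct moduli and their quotients are again roots of [F]. Let [c] be an
    image of extremal modulus whose modulus class has [m <= N / 2] elements.
    The quotients by [c], in both directions and both before and after
    conjugation, give [4 N - 3 m - 1] distinct roots of [F], so that
    [deg F + 1 >= 5 N / 2], whereas [deg F + 1 <= M]. *)

Local Notation evalQ q x := (map_poly ratr q).[x].
Local Notation mu := lebesgue_measure.

(** * Conjugates and Kronecker's theorem *)

(** With all the numbers written as polynomials in one [a], conjugating them amounts to replacing
    [a] by another root of its minimal polynomial. Induction on [s] with the two-generator theorem
    in characteristic 0; the earlier polynomials are composed with the one expressing [b]. *)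
Lemma primitive_element (C : numClosedFieldType) (s : seq C) :
  (forall x, x \in s -> algebraicOver ratr x) ->
  exists2 a : C, algebraicOver ratr a &
    forall x, x \in s -> exists q : {poly rat}, x = evalQ q a.
Proof.
elim: s => [|x s IH] alg_s.
  by exists 0 => //; exact: (algebraic0 (ratr : {rmorphism rat -> C})).
have [|b alg_b gen_b] := IH.
  by move=> y ys; apply: alg_s; rewrite inE ys orbT.
have alg_x : algebraicOver ratr x by apply: alg_s; rewrite inE eqxx.
have [px px_neq0 px_root] := alg_x; have [pb pb_neq0 pb_root] := alg_b.
have [n [[p Dp] [q Dq]]] :=
  @pchar0_PET _ _ (ratr : {rmorphism rat -> C}) x b px px_neq0 px_root
    pb pb_neq0 pb_root (pchar_num _).
exists (b *+ n - x).
  apply: (algebraic_sub (FtoE := (ratr : {rmorphism rat -> C}))) => //.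
  rewrite -mulr_natr; apply: (algebraic_mul (FtoE := (ratr : {rmorphism rat -> C}))) => //.
  by rewrite -(ratr_nat C n); exact: (algebraic_id (ratr : {rmorphism rat -> C})).
move=> y; rewrite inE => /orP[/eqP ->|/gen_b[r ->]]; first by exists p.
by exists (r \Po q); rewrite map_comp_poly horner_comp Dq.
Qed.

Lemma minimal_polynomial (C : numClosedFieldType) (a : C) :
  algebraicOver ratr a ->
  exists2 p : {poly rat}, p \is monic &
    forall q : {poly rat}, root (map_poly ratr q) a = (p %| q).
Proof.
move=> alg_a.
have isQ : decidable_embedding (ratr : {rmorphism rat -> C}).
  by move=> y; exact: pselect.
have int_a : integralOver (ratr : {rmorphism rat -> C}) a.
  by apply/integral_algebraic.
have [p [mon_p pa0 irr_p]] := minPoly_decidable_closure isQ int_a.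
exists p => // q; apply/idP/idP=> [qa0 | /dvdpP[r ->]]; last first.
  by rewrite rmorphM rootM pa0 orbT.
(* The gcd has the root [a], hence is not constant; irreducibility of [p] makes it associate to
   [p]. *)
suffices /eqp_dvdl <-: gcdp p q %= p by apply: dvdp_gcdr.
rewrite irr_p ?dvdp_gcdl ?gtn_eqF // -(size_map_poly (ratr : {rmorphism rat -> C})).
rewrite gcdp_map /=.
rewrite (@root_size_gt1 _ a) ?root_gcd ?pa0 //.
by rewrite gcdp_eq0 negb_and map_poly_eq0 monic_neq0.
Qed.

(** Write [p = r * g] with [g] the gcd of [p] and its derivative. Either [p] divides [r], and sizes
    force [g] to be constant, or [p] divides [g], hence the nonzero derivative of smaller degree,
    which is absurd. *)
Lemma minimal_polynomial_separable (C : numClosedFieldType) (a : C)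
    (p : {poly rat}) : p \is monic ->
  (forall q : {poly rat}, root (map_poly ratr q) a = (p %| q)) ->
  separable_poly p.
Proof.
move=> mon_p minp; have p0 := monic_neq0 mon_p.
have sp : (1 < size p)%N.
  have := minp p; rewrite dvdpp -(size_map_poly (ratr : {rmorphism rat -> C})).
  by move=> /root_size_gt1; apply; rewrite map_poly_eq0.
pose g := gcdp p p^`(); have /dvdpP[r Dp] : g %| p by rewrite dvdp_gcdl.
have := minp p; rewrite dvdpp {1}Dp rmorphM rootM !minp => /orP[pr|pg].
  have r0 : r != 0 by apply: contraNneq p0 => r0; rewrite Dp r0 mul0r.
  have g0 : g != 0 by apply: contraNneq p0 => g0; rewrite Dp g0 mulr0.
  have := dvdp_leq r0 pr; rewrite {1}Dp size_mul // separable_poly.unlock /coprimep -/g.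
  have : (0 < size g)%N by rewrite size_poly_gt0.
  have : (0 < size r)%N by rewrite size_poly_gt0.
  by case: (size g) => [|[|k]] // _ _; rewrite !addnS /= ltnNge leq_addr.
have pp' : p %| p^`() by rewrite (dvdp_trans pg) // dvdp_gcdr.
have p'0 : p^`() != 0.
  apply/eqP => /(congr1 (fun f : {poly rat} => f`_(size p).-2)).
  rewrite coef_deriv coef0.
  have -> : (size p).-2.+1 = (size p).-1 by case: (size p) sp => [|[]].
  rewrite -[p`_ _]/(lead_coef p) (monicP mon_p) => /eqP.
  by rewrite pnatr_eq0; case: (size p) sp => [|[]].
by have := dvdp_leq p'0 pp'; rewrite leqNgt lt_size_deriv.
Qed.

Lemma common_denominator n (g : nat -> {poly rat}) :
  exists2 K : int, K != 0 &
    forall i, (i < n)%N -> K%:~R *: g i \is a polyOver Num.int.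
Proof.
elim: n => [|n [K K0 HK]]; first by exists 1.
have [r [a a0 Dg]] := rat_poly_scale (g n).
exists (a * K) => [|i]; first by rewrite mulf_neq0.
rewrite ltnS leq_eqVlt => /predU1P[->|/HK h]; rewrite rmorphM /=.
  rewrite mulrC -scalerA Dg (scalerA a%:~R) divff ?intr_eq0 // scale1r.
  rewrite polyOverZ ?intr_int //; apply/polyOverP => j.
  by rewrite coef_map intr_int.
by rewrite -scalerA polyOverZ ?intr_int.
Qed.

(** Modulo [p], the monic relation [F] expresses [q ^+ d], with [d] the degree of [F], as an integer
    combination of lower powers. A common denominator of the first [d] residues therefore serves for
    all powers. *)
Lemma monic_powers_denominator (p q : {poly rat}) (F : {poly int}) :
  F \is monic -> p %| map_poly intr F \Po q ->
  exists2 K : int, K != 0 & forall m, K%:~R *: ((q ^+ m) %% p) \is a polyOver Num.int.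
Proof.
move=> monF pF; pose d := (size F).-1.
have [K K0 HK] := common_denominator d (fun i => (q ^+ i) %% p).
exists K => // m; elim/ltn_ind: m => m IH.
have [/HK //|dm] := ltnP m d.
have sF : size F = d.+1 by rewrite prednK // size_poly_gt0 monic_neq0.
have mod_sum (I : finType) (h : I -> {poly rat}) :
    (\sum_i h i) %% p = \sum_i (h i %% p).
  by apply: (big_morph (fun f => f %% p)) => [f1 f2|]; rewrite ?modpD ?mod0p.
have : (q ^+ (m - d) * (map_poly intr F \Po q)) %% p = 0.
  by apply: modp_eq0; exact: dvdp_mull.
rewrite comp_polyE size_map_inj_poly ?rmorph0 //; last exact: intr_inj.
rewrite sF big_ord_recr /= mulrDr modpD coef_map /=.
have -> : F`_d = 1 by apply/eqP; rewrite -[_ == _]/(F \is monic).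
rewrite rmorph1 scale1r -exprD subnK // mulr_sumr mod_sum.
move=> /eqP; rewrite addrC addr_eq0 => /eqP ->.
rewrite scalerN -scaleN1r polyOverZ ?rpredN1 // scaler_sumr rpred_sum // => i _.
rewrite coef_map /= -scalerAr modpZl scalerA mulrC -scalerA polyOverZ ?intr_int //.
by rewrite -exprD IH // -[ltnRHS](subnK dm) ltn_add2l.
Qed.

(** The residues of the powers of [q] modulo [p] have bounded denominators, and bounded coefficients
    because their values at all conjugates have modulus 1. There are thus finitely many residues,
    and two powers of [evalQ q a] coincide. *)
Lemma kronecker (C : numClosedFieldType) (a : C) (p q : {poly rat}) (F : {poly int}) :
  (forall x : C, exists n : nat, `|x| <= n%:R) ->
  p \is monic ->
  (forall f : {poly rat}, root (map_poly ratr f) a = (p %| f)) ->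
  F \is monic -> root (map_poly intr F) (evalQ q a) ->
  (forall b : C, root (map_poly ratr p) b -> `|evalQ q b| = 1) ->
  exists2 t, (0 < t)%N & evalQ q a ^+ t = 1.
Proof.
move=> archi mon_p minp monF Fq0 unimod.
have [K K0 HK] : exists2 K : int, K != 0 &
    forall m, K%:~R *: ((q ^+ m) %% p) \is a polyOver Num.int.
  apply: monic_powers_denominator monF _.
  rewrite -minp map_comp_poly /root horner_comp -map_poly_comp /=.
  by rewrite (eq_map_poly (g := intr)) // => x; rewrite /= ratr_int.
have [s Ds] := closed_field_poly_normal (map_poly ratr p : {poly C}).
rewrite lead_coef_map (monicP mon_p) rmorph1 scale1r in Ds.
have Us : uniq s.
  rewrite -separable_prod_XsubC -Ds separable_map.
  exact: minimal_polynomial_separable minp.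
pose n := size s.
have sz_p : size p = n.+1.
  by rewrite -(size_map_poly (ratr : {rmorphism rat -> C})) /= Ds size_prod_XsubC.
(* Coefficients are recovered from the values at the roots of [p] through the inverse of this
   matrix, invertible as the roots are distinct. *)
pose V := Vandermonde n (\row_(j < n) s`_j).
have uV : V \in unitmx.
  rewrite unitmxE unitfE det_Vandermonde; apply/prodf_neq0 => i _.
  apply/prodf_neq0 => j ij; rewrite !mxE subr_eq0 nth_uniq // neq_ltn ij orbT //.
pose r m : 'rV[C]_n := \row_j ratr ((q ^+ m) %% p)`_j.
have rV m : r m *m V = \row_j (evalQ q s`_j) ^+ m.
  apply/rowP => j; rewrite !mxE -horner_exp -rmorphXn /=.
  have : root (map_poly ratr p) s`_j by rewrite Ds root_prod_XsubC mem_nth.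
  move=> /rootP psj; rewrite (divp_eq (q ^+ m) p) rmorphD rmorphM hornerD hornerM.
  rewrite /= psj mulr0 add0r (@horner_coef_wide _ n); last first.
    by rewrite size_map_poly -ltnS -sz_p ltn_modp monic_neq0.
  by apply: eq_bigr => i _; rewrite !mxE coef_map.
have [B HB] : exists B : nat, forall j, \sum_i `|invmx V i j| <= B%:R.
  have [f Hf] := choice (fun j => archi (\sum_i `|invmx V i j|)).
  exists (\sum_j f j)%N => j; apply: le_trans (_ : (f j)%:R <= _).
    by apply: le_trans (Hf j); rewrite ger0_norm // sumr_ge0.
  by rewrite ler_nat (bigD1 j) //= leq_addr.
have bound m j : `|r m 0 j| <= B%:R.
  rewrite -[r m](mulmxK uV) rV mxE; apply: le_trans (HB j).
  apply: le_trans (ler_norm_sum _ _ _) _; apply: ler_sum => i _.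
  rewrite !mxE normrM normrX unimod ?expr1n ?mul1r //.
  by rewrite Ds root_prod_XsubC mem_nth.
(* After scaling by [K] each coefficient is an integer in [[-N, N]]; adding [N] encodes it as an
   ordinal. *)
pose N := (`|K| * B)%N.
have code m (j : 'I_n) : exists k : 'I_(N + N).+1,
    K%:~R * ((q ^+ m) %% p)`_j = k%:R - N%:R :> rat.
  have /polyOverP/(_ j) := HK m; rewrite coefZ => /intrP[x Dx].
  have : `|x| <= N%:Z.
    rewrite -(ler_int rat) intr_norm -Dx normrM /N PoszM rmorphM /= abszE intr_norm.
    apply: ler_wpM2l; first exact: normr_ge0.
    by rewrite -(ler_rat C) ratr_norm ratr_int; have := bound m j; rewrite mxE.
  rewrite ler_norml => /andP[lo hi].
  have kP : (`|(x + N%:Z)%R|%N < (N + N).+1)%N.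
    by rewrite ltnS -lez_nat gez0_abs ?PoszD ?lerD2r // -lerBlDr sub0r.
  exists (Ordinal kP); rewrite Dx /= !pmulrn gez0_abs; last by rewrite -lerBlDr sub0r.
  by rewrite -intrB addrK.
pose cd m := projT1 (choice (code m)).
have Hcd m : forall j : 'I_n, K%:~R * ((q ^+ m) %% p)`_j = (cd m j)%:R - N%:R :> rat.
  exact: projT2 (choice (code m)).
pose T := {ffun 'I_n -> 'I_(N + N).+1}.
(* Pigeonhole: one more power than there are possible codes. *)
pose h (i : 'I_#|T|.+1) : T := [ffun j => cd i j].
have /injectivePn[i [i' ii' hh]] : ~~ injectiveb h.
  apply/negP => /injectiveP/leq_card; rewrite card_ord ltnn //.
have eq_r (k k' : 'I_#|T|.+1) : h k = h k' -> (q ^+ k) %% p = (q ^+ k') %% p.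
  move=> hk; apply/polyP => j; have [jn|jn] := ltnP j n; last first.
    by rewrite !nth_default // (leq_trans _ jn) // -ltnS -sz_p ltn_modp monic_neq0.
  have := congr1 (fun f : T => f (Ordinal jn)) hk; rewrite !ffunE => e.
  apply: (@mulfI _ K%:~R); first by rewrite intr_eq0.
  by have := Hcd k (Ordinal jn); have := Hcd k' (Ordinal jn); rewrite /= e => -> ->.
have powers (k k' : 'I_#|T|.+1) : (k < k')%N -> h k = h k' ->
    exists2 t, (0 < t)%N & evalQ q a ^+ t = 1.
  move=> kk' /eq_r e; exists (k' - k)%N; first by rewrite subn_gt0.
  have : root (map_poly ratr (q ^+ k' - q ^+ k)) a.
    by rewrite minp; apply/modp_eq0P; rewrite modpD modpN e subrr.
  rewrite rmorphB !rmorphXn /root /= !hornerE subr_eq0 -{1}(subnK (ltnW kk')) exprD.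
  set y := evalQ q a => /eqP yk.
  have y0 : y != 0.
    rewrite -normr_eq0 unimod ?oner_eq0 // minp dvdpp //.
  by apply: (mulIf (expf_neq0 k y0)); rewrite mul1r.
have [/powers|/powers|/val_inj] := ltngtP i i'; [exact|by apply|].
by move=> e; rewrite e eqxx in ii'.
Qed.

(** Contrapositive of Kronecker's theorem. The pair [a], [b] stands for the embedding of Q(a) that
    sends [a] to [b]: by the second clause every rational relation between the [z i] passes to their
    conjugates. *)
Lemma exists_nonunimodular_conjugate (C : numClosedFieldType) (I : finType)
    (z : I -> C) (F : {poly int}) (i0 : I) :
  (forall x : C, exists n : nat, `|x| <= n%:R) ->
  F \is monic -> (forall i, algebraicOver ratr (z i)) ->
  root (map_poly intr F) (z i0) -> (forall t, (0 < t)%N -> z i0 ^+ t != 1) ->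
  exists (a b : C) (q : I -> {poly rat}),
    [/\ forall i, z i = evalQ (q i) a,
        forall f : {poly rat}, evalQ f a = 0 -> evalQ f b = 0 &
        `|evalQ (q i0) b| != 1].
Proof.
move=> archi monF alg_z Fz nz.
have [|a alg_a gen_a] := @primitive_element C [seq z i | i : I].
  by move=> x /mapP[i _ ->].
have [q Hq] : exists q : I -> {poly rat}, forall i, z i = evalQ (q i) a.
  pose ch i := gen_a (z i) (map_f z (mem_enum I i)).
  by exists (fun i => sval (cid (ch i))) => i; exact: (svalP (cid (ch i))).
have [p mon_p minp] := minimal_polynomial alg_a.
have [[b [pb nb]]|H] :=
    pselect (exists b : C, root (map_poly ratr p) b /\ `|evalQ (q i0) b| != 1).
  exists a, b, q; split=> // f /rootP; rewrite minp => /dvdpP[r ->].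
  by rewrite rmorphM hornerM (rootP pb) mulr0.
rewrite Hq in Fz.
have [b pb|t t0] := kronecker archi mon_p minp monF Fz.
  by apply: contrapT => nb; apply: H; exists b; split=> //; apply/eqP.
by rewrite -Hq => e; have := nz t t0; rewrite e eqxx.
Qed.

(** * Counting roots among quotients *)

(* The roots exhibited are the [z j / z c], the [z c / z j] with [j] outside the
   class of [c], and the same non-unimodular quotients for [w]; minimality of
   [`|w c|] keeps the first two families apart. *)
Lemma roots_of_quotients (C : numClosedFieldType) (N : nat) (P : {poly C})
    (z w : 'I_N -> C) (c : 'I_N) :
  P != 0 -> ~~ root P 1 ->
  (forall j, `|z j| = 1) -> (forall j, w j != 0) ->
  (forall j k, j != k -> root P (z j / z k)) ->
  (forall j k, j != k -> root P (w j / w k)) ->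
  (forall j k, z j * z k = z c ^+ 2 -> w j * w k = w c ^+ 2) ->
  (forall j, `|w c| <= `|w j|) ->
  (4 * N <= 3 * #|[pred j | `|w j| == `|w c|]%R| + size P)%N.
Proof.
move=> P0 P1 z1 w0 Pz Pw rel cmin.
have z0 j : z j != 0 by rewrite -normr_eq0 z1 oner_eq0.
have inj_quot (x : 'I_N -> C) : (forall j, x j != 0) ->
    (forall j k, j != k -> root P (x j / x k)) -> injective x.
  move=> x0 Px j k e; apply/eqP; apply: contraNT P1 => /Px.
  by rewrite e divff.
have zinj := inj_quot z z0 Pz; have winj := inj_quot w w0 Pw.
have divl_inj (x : 'I_N -> C) : (forall j, x j != 0) -> injective x ->
    injective (fun j => x j / x c).
  by move=> x0 xinj j k /= /mulIf e; apply/xinj/e; rewrite invr_eq0.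
have divr_inj (x : 'I_N -> C) : (forall j, x j != 0) -> injective x ->
    injective (fun j => x c / x j).
  by move=> x0 xinj j k /= /mulfI e; apply/xinj/invr_inj/e.
pose U := enum [pred j | j != c]; pose V := enum [pred j | `|w j| != `|w c|].
have cV j : j \in V -> `|w c| < `|w j|.
  by rewrite mem_enum inE lt_def cmin andbT.
have jVc j : j \in V -> j != c.
  by move=> /cV; apply: contraTneq => ->; rewrite ltxx.
have wc0 : 0 < `|w c| by rewrite normr_gt0.
pose S1 := [seq z j / z c | j <- U]; pose S2 := [seq z c / z j | j <- V].
pose S3 := [seq w j / w c | j <- V]; pose S4 := [seq w c / w j | j <- V].
have S12 x : x \in S1 ++ S2 -> `|x| = 1.
  by rewrite mem_cat => /orP[] /mapP[j _ ->]; rewrite normrM normfV !z1 divr1.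
have S3n x : x \in S3 -> 1 < `|x|.
  by move=> /mapP[j /cV jc ->]; rewrite normrM normfV ltr_pdivlMr ?mul1r.
have S4n x : x \in S4 -> `|x| < 1.
  move=> /mapP[j /cV jc ->]; rewrite normrM normfV ltr_pdivrMr ?mul1r //.
  exact: lt_trans jc.
pose S := (S1 ++ S2) ++ (S3 ++ S4).
have US : uniq S.
  rewrite /S cat_uniq cat_uniq cat_uniq !map_inj_uniq ?enum_uniq //=;
    try by [apply: divl_inj|apply: divr_inj].
  rewrite andbT; apply/and3P; split.
  - apply/hasPn => x /mapP[k /cV kc ->]; apply/negP => /mapP[j _ e].
    (* A coincidence [z j / z c = z c / z k] transfers to [w j * w k = w c ^+ 2], whereas
       [|w j| >= |w c|] and [|w k| > |w c|]. *)
    have /rel : z j * z k = z c ^+ 2.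
      by apply: (mulIf (invr_neq0 (z0 k))); rewrite mulfK // expr2 -mulrA e mulrC divfK.
    move=> /(congr1 Num.norm); rewrite normrX normrM expr2 => e'.
    have : `|w c| * `|w c| < `|w j| * `|w k|.
      by apply: le_lt_trans (_ : `|w j| * `|w c| < _); rewrite ?ler_pM2r ?ltr_pM2l // normr_gt0.
    by rewrite e' ltxx.
  - apply/hasPn => x; rewrite mem_cat => xS; apply/negP => /S12 x1.
    by case/orP: xS => [/S3n|/S4n]; rewrite x1 ltxx.
  - rewrite andbT; apply/hasPn => x /S4n x1; apply/negP => /S3n /(lt_trans x1).
    by rewrite ltxx.
have rS : all (root P) S.
  apply/allP => x; rewrite !mem_cat.
  case/orP => /orP[] /mapP[j jX ->].
  - by apply: Pz; move: jX; rewrite mem_enum.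
  - by apply: Pz; rewrite eq_sym jVc.
  - by apply: Pw; rewrite jVc.
  - by apply: Pw; rewrite eq_sym jVc.
have := max_poly_roots P0 rS US.
have cU : size U = N.-1.
  by rewrite -cardE cardC1 card_ord.
have cVm : (size V + #|[pred j | `|w j| == `|w c|]%R| = N)%N.
  rewrite addnC -cardE -[RHS]card_ord -(cardC [pred j | `|w j| == `|w c|]%R); congr (_ + _)%N.
have N0 : (0 < N)%N := leq_ltn_trans (leq0n c) (ltn_ord c).
(* With [m] the size of the class of [c], the [N - 1 + 3 * (N - m)] distinct roots are fewer than
   [size P]. *)
rewrite /S !size_cat !size_map cU; move: N0 cVm; clear; move: #|_| (size V) (size P) => m v s; lia.
Qed.

(** The count is made at an index of minimal modulus and at one of maximal modulus. Their modulus
    classes are disjoint, so the two class sizes sum to at most [N], and adding both bounds gives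
    [8 * N <= 3 * N + 2 * size P]. *)
Lemma five_halves_bound (C : numClosedFieldType) (N : nat) (P : {poly C})
    (z w : 'I_N -> C) (j0 j1 : 'I_N) :
  P != 0 -> ~~ root P 1 ->
  (forall j, `|z j| = 1) -> (forall j, w j != 0) ->
  (forall j k, j != k -> root P (z j / z k)) ->
  (forall j k, j != k -> root P (w j / w k)) ->
  (forall c j k, z j * z k = z c ^+ 2 -> w j * w k = w c ^+ 2) ->
  `|w j0| != `|w j1| ->
  (5 * N <= 2 * size P)%N.
Proof.
move=> P0 P1 z1 w0 Pz Pw rel w01.
have real_w (i : 'I_N) : xpredT i -> `|w i| \is Num.real by rewrite normr_real.
have [c _ cmin] := real_arg_minP (erefl : xpredT j0) real_w.
have [d _ dmaxP] := real_arg_maxP (erefl : xpredT j0) real_w.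
have dmax j : `|w j| <= `|w d| := dmaxP j isT.
have cd : `|w c| != `|w d|.
  apply: contraNneq w01 => cd.
  have E j : `|w j| = `|w c| by apply/le_anti; rewrite cmin // cd dmax.
  by rewrite !E.
have Hc : (4 * N <= 3 * #|[pred j | `|w j| == `|w c|]%R| + size P)%N.
  by apply: (roots_of_quotients P0 P1 z1 w0 Pz Pw (rel c)) => j; exact: cmin.
(* Passing to inverses makes the maximal modulus minimal and merely swaps the quotients for [(j, k)]
   and [(k, j)]. *)
have Hd : (4 * N <= 3 * #|[pred j | `|(w j)^-1| == `|(w d)^-1|]%R| + size P)%N.
  apply: (@roots_of_quotients _ _ _ (fun j => (z j)^-1) (fun j => (w j)^-1)) => //.
  - by move=> j; rewrite normfV z1 invr1.
  - by move=> j; rewrite invr_eq0.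
  - by move=> j k jk; rewrite invrK mulrC Pz // eq_sym.
  - by move=> j k jk; rewrite invrK mulrC Pw // eq_sym.
  - move=> j k; rewrite -invfM exprVn => /invr_inj/rel e.
    by rewrite -invfM e exprVn.
  - move=> j; rewrite !normfV lef_pV2 ?posrE ?normr_gt0 //; exact: dmax.
have : (#|[pred j | `|w j| == `|w c|]%R| + #|[pred j | `|(w j)^-1| == `|(w d)^-1|]%R| <= N)%N.
  rewrite -[leqRHS]card_ord -(cardC [pred j | `|w j| == `|w c|]%R) leq_add2l.
  apply: subset_leq_card; apply/fintype.subsetP => j; rewrite !inE !normfV (inj_eq invr_inj).
  by move=> /eqP ->; rewrite eq_sym.
lia.
Qed.

Lemma short_spectrum_torsion (C : numClosedFieldType) (N : nat) (F : {poly int})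
    (z : 'I_N -> C) (i0 : 'I_N) :
  (forall x : C, exists n : nat, `|x| <= n%:R) ->
  F \is monic -> F.[0] != 0 -> F.[1] != 0 ->
  (forall j, `|z j| = 1) -> z i0 = 1 ->
  (forall j k, j != k -> root (map_poly intr F) (z j / z k)) ->
  (2 * size F < 5 * N)%N ->
  forall j, exists2 t, (0 < t)%N & z j ^+ t = 1.
Proof.
move=> archi monF F0 F1 z1 zi0 Fz ltF j1; apply: contrapT => Hj1.
have nz t : (0 < t)%N -> z j1 ^+ t != 1.
  by move=> t0; apply/eqP => e; apply: Hj1; exists t.
have j10 : j1 != i0.
  by apply: contraNneq (nz 1%N isT) => ->; rewrite zi0 expr1.
have z0 j : z j != 0 by rewrite -normr_eq0 z1 oner_eq0.
(* The family to be conjugated consists of the quotients themselves, which are algebraic as roots of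
   [F] or equal to 1. *)
pose u (jk : 'I_N * 'I_N) := z jk.1 / z jk.2.
have alg_u jk : algebraicOver ratr (u jk).
  case: jk => j k; rewrite /u /=; have [->|jk] := eqVneq j k.
    by rewrite divff //; exact: (algebraic1 (ratr : {rmorphism rat -> C})).
  exists (map_poly intr F); first by rewrite map_poly_eq0_id0 ?monic_neq0 // (monicP monF).
  rewrite -map_poly_comp (eq_map_poly (g := intr)) ?Fz // => x.
  by rewrite /= ratr_int.
have evF (q : {poly rat}) (x : C) :
    evalQ (map_poly intr F \Po q) x = (map_poly intr F).[evalQ q x].
  rewrite map_comp_poly horner_comp -map_poly_comp /=.
  by rewrite (eq_map_poly (g := intr)) // => y; rewrite /= ratr_int.
have FC (x : int) : (map_poly intr F : {poly C}).[x%:~R] = F.[x]%:~R.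
  exact: horner_map.
have [||a [b [q [Hq ab nb]]]] :=
  @exists_nonunimodular_conjugate C _ u F (j1, i0) archi monF alg_u.
- exact: Fz.
- by move=> t t0; rewrite /u /= zi0 divr1 nz.
pose v jk := evalQ (q jk) b.
(* The cocycle relation of the quotients survives conjugation; it yields that the [v jk] are nonzero
   and are the quotients of the [w j]. *)
have vM j k l : v (j, k) * v (k, l) = v (j, l).
  apply/eqP; rewrite -subr_eq0 -hornerM -rmorphM -hornerN -hornerD -rmorphB.
  apply/eqP/ab; rewrite rmorphB rmorphM !hornerE -!Hq /u /=.
  by rewrite mulrA divfK // subrr.
have vjj j : v (j, j) = 1.
  have ev1 : 1 = evalQ 1 b :> C by rewrite rmorph1 hornerC.
  apply/eqP; rewrite -subr_eq0 ev1 -hornerN -hornerD -rmorphB.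
  by apply/eqP/ab; rewrite rmorphB rmorph1 !hornerE -!Hq /u /= divff ?subrr.
have v0 j k : v (j, k) != 0.
  apply/eqP => e; have := vM j k j; rewrite e mul0r vjj => /eqP.
  by rewrite eq_sym oner_eq0.
pose w j := v (j, i0).
have wE j k : w j / w k = v (j, k).
  by apply: (mulIf (v0 k i0)); rewrite divfK ?vM //; exact: v0.
have szF : size (map_poly intr F : {poly C}) = size F.
  by rewrite size_map_inj_poly ?rmorph0 //; exact: intr_inj.
suff : (5 * N <= 2 * size (map_poly intr F : {poly C}))%N by rewrite szF leqNgt ltF.
(* The two distinct moduli occur at [j1], where the conjugate is off the unit circle, and at [i0],
   where [w i0 = 1]. *)
apply: (@five_halves_bound _ _ _ z w j1 i0).
- by rewrite -size_poly_eq0 szF size_poly_eq0 monic_neq0.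
- by rewrite /root -[1]/(1%:~R) FC intr_eq0.
- exact: z1.
- by move=> j; exact: v0.
- exact: Fz.
- move=> j k jk; rewrite wE /root -evF; apply/eqP/ab.
  by rewrite evF -Hq; apply/rootP/Fz.
- move=> c j k e; apply/eqP; rewrite -subr_eq0 /w /v -hornerM -rmorphM -horner_exp.
  rewrite -rmorphXn -hornerN -hornerD -rmorphB; apply/eqP/ab.
  rewrite rmorphB rmorphM rmorphXn !hornerE -!Hq /u /= zi0 !divr1.
  by rewrite e subrr.
- by rewrite /w vjj normr1.
Qed.

(** * Integrals over unions of unit intervals *)

Definition cell {R : realType} (a : nat) : set R := `[a%:R, a.+1%:R[.

Lemma measurable_cell (R : realType) a : measurable (@cell R a).
Proof. exact: measurable_itv. Qed.

Lemma mem_cell (R : realType) a (x : R) : cell a x <-> Num.truncn x = a /\ 0 <= x.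
Proof.
rewrite /cell /= in_itv /=; split=> [ax|[<- x0]]; last exact: truncn_itv.
by split; [exact: truncn_def|case/andP: ax => + _; apply: le_trans].
Qed.

Lemma Omega_cons (R : realType) a (A : seq nat) :
  @Omega R (a :: A) = cell a `|` Omega A.
Proof.
apply/seteqP; split=> x.
  move=> [b]; rewrite inE => /orP[/eqP ->|bA] [bx xb].
    by left; rewrite /cell /= in_itv /= bx -natr1 xb.
  by right; exists b.
move=> [|[b bA bx]]; last by exists b => //; rewrite inE bA orbT.
by rewrite /cell /= in_itv /= -natr1 => /andP[ax xa]; exists a; rewrite ?inE ?eqxx.
Qed.

Lemma Omega_nil (R : realType) : @Omega R [::] = set0.
Proof. by apply/seteqP; split => x // -[]. Qed.

Lemma cell_Omega (R : realType) a (A : seq nat) :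
  a \in A -> @cell R a `<=` Omega A.
Proof.
move=> aA x; rewrite /cell /= in_itv /= -natr1 => /andP[ax xa].
by exists a.
Qed.

Lemma measurable_Omega (R : realType) (A : seq nat) : measurable (@Omega R A).
Proof.
elim: A => [|a A IH]; first by rewrite Omega_nil.
by rewrite Omega_cons; apply: measurableU => //; exact: measurable_cell.
Qed.

Lemma integrable_cell (R : realType) a (h k : R -> R) :
  continuous k -> (forall x, cell a x -> h x = k x) ->
  mu.-integrable (cell a) (EFin \o h).
Proof.
move=> ck hk; apply: (@eq_integrable _ _ _ mu _ _ (EFin \o k)).
- exact: measurable_cell.
- by move=> x; rewrite inE => ax /=; rewrite hk.
apply: (@integrableS _ _ _ mu `[a%:R, a.+1%:R]).
- exact: measurable_itv.
- exact: measurable_cell.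
- by apply: subset_itvl; rewrite bnd_simp.
apply: continuous_compact_integrable; first exact: segment_compact.
exact: continuous_subspaceT.
Qed.

(** Only agreement with a continuous [k a] on each cell is asked of [h], so that products with step
    functions are covered. Integrability is carried through the induction because additivity of the
    integral requires it. *)
Lemma Rintegral_Omega (R : realType) (A : seq nat) (h : R -> R)
    (k : nat -> R -> R) : uniq A ->
  (forall a, continuous (k a)) ->
  (forall a x, a \in A -> cell a x -> h x = k a x) ->
  mu.-integrable (Omega A) (EFin \o h) /\
  Rintegral mu (Omega A) h = \sum_(a <- A) Rintegral mu (cell a) (k a).
Proof.
move=> + ck; elim: A => [|a A IH] /=.
  by move=> _ _; rewrite Omega_nil Rintegral_set0 big_nil; split=> //; exact: integrable_set0.
move=> /andP[aA uA] hk.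
have [|intA sumA] := IH uA; first by move=> b x bA; apply: hk; rewrite inE bA orbT.
have hka x : cell a x -> h x = k a x by apply: hk; rewrite inE eqxx.
have inta := integrable_cell (ck a) hka.
have dis : [disjoint cell a & @Omega R A].
  apply/disj_setPS => x [/mem_cell[xa x0] [b bA [bx xb]]].
  move: aA; rewrite -xa (_ : Num.truncn x = b) ?bA //.
  by apply: truncn_def; rewrite bx -natr1.
have ma := @measurable_cell R a; have mA := @measurable_Omega R A.
have intaA : mu.-integrable (cell a `|` Omega A) (EFin \o h).
  have [m1 i1] := integrableP _ _ _ inta; have [m2 i2] := integrableP _ _ _ intA.
  have mU := (measurable_funU _ ma mA).2 (conj m1 m2).
  apply/integrableP; split=> //.
  rewrite ge0_integral_setU //=; first by rewrite lte_add_pinfty.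
  by apply/measurable_EFinP; apply: measurableT_comp => //; exact/measurable_EFinP.
rewrite Omega_cons big_cons; split=> //.
rewrite Rintegral_setU // sumA; congr (_ + _).
by apply: eq_Rintegral => x; rewrite inE => /hka.
Qed.

Lemma Rintegral_cell_FTC (R : realType) (a : nat) (F f : R -> R) :
  (forall x : R, is_derive x (1 : R) F (f x)) -> continuous f ->
  Rintegral mu (cell a) f = F a.+1%:R - F a%:R.
Proof.
move=> dF cf; rewrite Rintegral_itv_bndo_bndc; last exact: (@integrable_cell _ _ _ f).
have cF : continuous F.
  by move=> x; apply/differentiable_continuous/derivable1_diffP; apply: ex_derive.
rewrite /Rintegral (@continuous_FTC2 _ f F) //.
- by rewrite ltr_nat.
- exact: continuous_subspaceT.
- split=> [x _||]; first exact: ex_derive.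
  + by apply: cvg_at_right_filter; exact: cF.
  + by apply: cvg_at_left_filter; exact: cF.
- by move=> x _; rewrite derive1E derive_val.
Qed.

(** * Exponentials and their integrals over cells *)

Definition cexp {R : realType} (t : R) : R[i] := cos (2 * pi * t) +i* sin (2 * pi * t).

Lemma cexpD (R : realType) (s t : R) : cexp (s + t) = cexp s * cexp t.
Proof.
rewrite /cexp mulrDr cosD sinD; apply/eqP.
by rewrite eq_complex /= eqxx addrC /= eqxx.
Qed.

Lemma cexp0 (R : realType) : cexp (0 : R) = 1.
Proof. by rewrite /cexp mulr0 cos0 sin0. Qed.

Lemma cexpMn (R : realType) (t : R) n : cexp (t * n%:R) = cexp t ^+ n.
Proof.
elim: n => [|n IH]; first by rewrite mulr0 cexp0.
by rewrite -natr1 mulrDr mulr1 cexpD IH exprSr.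
Qed.

Lemma norm_cexp (R : realType) (t : R) : `|cexp t| = 1.
Proof. by rewrite normc_def /= cos2Dsin2 sqrtr1. Qed.

Lemma cexp_neq0 (R : realType) (t : R) : cexp t != 0.
Proof. by rewrite -normr_eq0 norm_cexp oner_eq0. Qed.

Lemma cexpB (R : realType) (s t : R) : cexp (s - t) = cexp s / cexp t.
Proof.
by apply: (mulIf (cexp_neq0 t)); rewrite -cexpD subrK divfK // cexp_neq0.
Qed.

(** Let [r] be the fractional part of [t]. If [r > 0] then [sin (pi * r) > 0], and [cos (2 * pi * r)
    = 1 - 2 * sin (pi * r) ^+ 2] is less than 1. *)
Lemma cexp_eq1 (R : realType) (t : R) : cexp t = 1 -> exists n : int, t = n%:~R.
Proof.
move=> e1; exists (Num.floor t); set n := Num.floor t.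
have en : cexp (n%:~R : R) = 1.
  have en m : cexp (m%:R : R) = 1.
    rewrite -[m%:R]mul1r cexpMn /cexp mulr1 -[2]/(2%:R) mulr_natl cos2pi sin2pi.
    by rewrite expr1n.
  case: (n) => m; first exact: en.
  by rewrite NegzE rmorphN /= -[- _]sub0r cexpB cexp0 -[_%:~R]/(m.+1%:R) en divr1.
have er : cexp (t - n%:~R) = 1 by rewrite cexpB e1 en divr1.
pose r := t - n%:~R.
have r0 : 0 <= r by rewrite subr_ge0 ge_floor.
have r1 : r < 1 by rewrite ltrBlDl -intrD1 floorD1_gt.
apply/eqP; rewrite -subr_eq0 -/r; apply/negPn/negP => rn0.
have spos : 0 < sin (pi * r).
  have rpos : 0 < r by rewrite lt_def rn0.
  by apply: sin_gt0_pi; rewrite mulr_gt0 ?pi_gt0 //= gtr_pMr // pi_gt0.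
have := congr1 (@complex.Re R) er; rewrite /= -/r -mulrA -[2]/(2%:R) mulr_natl.
rewrite cos_mulr2n => h; have := cos2Dsin2 (pi * r).
have : 0 < sin (pi * r) ^+ 2 by rewrite exprn_gt0.
move: h; rewrite mulr2n; lra.
Qed.

Definition cellint {R : realType} (l : R) (a : nat) : R[i] :=
  Rintegral mu (cell a) (fun x => cos (2 * pi * l * x)) +i*
  Rintegral mu (cell a) (fun x => sin (2 * pi * l * x)).

Lemma continuous_cosM (R : realType) (c : R) : continuous (fun x : R => cos (c * x)).
Proof.
by move=> x; apply: continuous_comp; [exact: mulrl_continuous|exact: continuous_cos].
Qed.

Lemma continuous_sinM (R : realType) (c : R) : continuous (fun x : R => sin (c * x)).
Proof.
by move=> x; apply: continuous_comp; [exact: mulrl_continuous|exact: continuous_sin].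
Qed.

Lemma cellintE (R : realType) (l : R) (a : nat) : l != 0 ->
  (2 * pi * l)%:C * 'i * cellint l a = cexp (l * a.+1%:R) - cexp (l * a%:R).
Proof.
move=> l0; have c0 : 2 * pi * l != 0 by rewrite !mulf_neq0 ?pnatr_eq0 // gt_eqF ?pi_gt0.
rewrite /cellint; set c := 2 * pi * l in c0 *.
have dcx (x : R) : is_derive x (1 : R) ( *%R c) c.
  by apply: (is_derive_eq (f := c \*: (id : R -> R))); rewrite /GRing.scale /= mulr1.
have dS (x : R) : is_derive x (1 : R) (fun x => c^-1 * sin (c * x)) (cos (c * x)).
  apply: (is_derive_eq (f := c^-1 \*: (sin \o ( *%R c)))).
  by rewrite /GRing.scale /= mulrC mulfK.
have dC (x : R) : is_derive x (1 : R) (fun x => - c^-1 * cos (c * x)) (sin (c * x)).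
  apply: (is_derive_eq (f := (- c^-1) \*: (cos \o ( *%R c)))).
  by rewrite /GRing.scale /= mulrC mulNr mulrN mulNr opprK mulfK.
rewrite (Rintegral_cell_FTC a dS (@continuous_cosM R c)).
rewrite (Rintegral_cell_FTC a dC (@continuous_sinM R c)).
rewrite /cexp !mulrA -/c; apply/eqP; rewrite eq_complex /=.
by apply/andP; split; apply/eqP; field.
Qed.

Lemma lebesgue_measure_cell (R : realType) a : mu (@cell R a) = 1%E.
Proof.
rewrite [LHS]lebesgue_measure_itv /= lte_fin ltr_nat ltnSn.
by rewrite -EFinB /= -natr1 addrAC subrr add0r.
Qed.

Lemma Rintegral_cell_cst (R : realType) a (r : R) : Rintegral mu (cell a) (cst r) = r.
Proof.
transitivity (r * fine (lebesgue_measure (@cell R a))).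
  by apply: Rintegral_cst; exact: measurable_cell.
by rewrite lebesgue_measure_cell mulr1.
Qed.

(** Translating the unit interval by [a] multiplies the exponential by [cexp l ^+ a]. For nonzero
    [l] this is read off the closed form [cellintE]; for [l = 0] both integrals are 1. *)
Lemma cellint_shift (R : realType) (l : R) (a : nat) :
  cellint l a = cexp l ^+ a * cellint l 0.
Proof.
have [->|l0] := eqVneq l 0.
  rewrite cexp0 expr1n mul1r.
  have E b : cellint (0 : R) b = 1.
    have Ec : Rintegral mu (cell b) (fun x : R => cos (2 * pi * 0 * x)) =
        Rintegral mu (cell b) (cst 1).
      by apply: eq_Rintegral => x _; rewrite mulr0 mul0r cos0.
    have Es : Rintegral mu (cell b) (fun x : R => sin (2 * pi * 0 * x)) =
        Rintegral mu (cell b) (cst 0).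
      by apply: eq_Rintegral => x _; rewrite mulr0 mul0r sin0.
    rewrite /cellint Ec Es.
    by rewrite !Rintegral_cell_cst.
  by rewrite !E.
have c0 : (2 * pi * l)%:C * 'i != 0 :> R[i].
  rewrite mulf_neq0 // ?eq_complex /= ?eqxx ?andbT ?oner_eq0 ?andbF //.
  by rewrite !mulf_neq0 ?pnatr_eq0 // gt_eqF ?pi_gt0.
apply: (mulfI c0); rewrite mulrCA !cellintE // !cexpMn mulrBr.
by rewrite expr1 expr0 mulr1 -exprSr.
Qed.

Lemma cellint_neq0 (R : realType) (l : R) : cexp l != 1 -> cellint l 0 != 0.
Proof.
move=> e1; have l0 : l != 0 by apply: contraNneq e1 => ->; rewrite cexp0.
apply: contraNneq e1 => c0; have := cellintE 0 l0.
rewrite c0 mulr0 !cexpMn expr0 expr1 => /esym/eqP.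
by rewrite subr_eq0.
Qed.

Lemma cellintN (R : realType) (l : R) (a : nat) :
  cellint (- l) a = complex.Re (cellint l a) -i* complex.Im (cellint l a).
Proof.
rewrite /cellint /=; congr (_ +i* _).
  by apply: eq_Rintegral => x _; rewrite mulrN mulNr cosN.
rewrite -[RHS]mulN1r -RintegralZl; [|exact: measurable_cell|].
  by apply: eq_Rintegral => x _; rewrite mulrN mulNr sinN mulN1r.
by apply: (@integrable_cell _ _ _ (fun x => sin (2 * pi * l * x))) => //; exact: continuous_sinM.
Qed.

(** Turns orthogonality into a root of the mask polynomial: the integral over [Omega A] is
    [cellint t 0] times this sum, and the first factor is nonzero. *)
Lemma sum_cexp_eq0 (R : realType) (A : seq nat) (t : R) :
  uniq A -> cexp t != 1 ->
  Rintegral mu (Omega A) (fun x => cos (2 * pi * t * x)) = 0 ->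
  Rintegral mu (Omega A) (fun x => sin (2 * pi * t * x)) = 0 ->
  \sum_(a <- A) cexp t ^+ a = 0.
Proof.
move=> uA e1 c0 s0; apply: (mulIf (cellint_neq0 e1)); rewrite mul0r mulr_suml.
under eq_bigr do rewrite -cellint_shift.
have [_] := Rintegral_Omega uA (fun=> @continuous_cosM R (2 * pi * t)) (fun _ _ _ _ => erefl).
have [_] := Rintegral_Omega uA (fun=> @continuous_sinM R (2 * pi * t)) (fun _ _ _ _ => erefl).
rewrite c0 s0 => sinE cosE.
have -> : \sum_(a <- A) cellint t a =
    (\sum_(a <- A) Rintegral mu (cell a) (fun x => cos (2 * pi * t * x))) +i*
    (\sum_(a <- A) Rintegral mu (cell a) (fun x => sin (2 * pi * t * x))).
  elim: A {uA c0 s0 sinE cosE} => [|a A IH]; first by rewrite !big_nil.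
  by rewrite !big_cons IH.
by rewrite -sinE -cosE.
Qed.

(** * Step functions and their inner products *)

(** On nonnegative reals truncation gives the index of the cell; negative reals, all outside
    [Omega A], receive the value [c 0]. *)
Definition stepf {R : realType} (c : nat -> R) (x : R) : R := c (Num.truncn x).

Lemma stepf_cell (R : realType) (c : nat -> R) a x : cell a x -> stepf c x = c a.
Proof. by move=> /mem_cell[xa _]; rewrite /stepf xa. Qed.

Lemma L2_stepf (R : realType) (A : seq nat) (c : nat -> R) :
  uniq A -> L2 (Omega A) (stepf c).
Proof.
move=> uA; split.
  have [|h _] := @Rintegral_Omega R A (stepf c) (fun a => cst (c a)) uA
    (fun a => @cst_continuous _ _ (c a)).
    by move=> a x _; exact: stepf_cell.
  by apply/measurable_EFinP; exact: measurable_int h.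
have [|h _] := @Rintegral_Omega R A (fun x => stepf c x ^+ 2) (fun a => cst (c a ^+ 2)) uA
    (fun a => @cst_continuous _ _ (c a ^+ 2)); last exact: h.
by move=> a x _ ax; rewrite (stepf_cell c ax).
Qed.

(** The frequency changes sign because the inner product conjugates the exponential. *)
Lemma ip_stepf (R : realType) (A : seq nat) (c : nat -> R[i]) (l : R) :
  uniq A ->
  let u := stepf (fun a => complex.Re (c a)) in
  let v := stepf (fun a => complex.Im (c a)) in
  ip_re (Omega A) u v l +i* ip_im (Omega A) u v l =
  \sum_(a <- A) c a * cellint (- l) a.
Proof.
move=> uA u v; pose L := 2 * pi * l.
have pcos (p : R) : continuous (fun x : R => p * cos (L * x)).
  by move=> x; apply: continuousM; [exact: cst_continuous|exact: continuous_cosM].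
have psin (p : R) : continuous (fun x : R => p * sin (L * x)).
  by move=> x; apply: continuousM; [exact: cst_continuous|exact: continuous_sinM].
have ipL (p q : R) a : Rintegral mu (cell a) (fun x => p * cos (L * x) + q * sin (L * x)) =
    p * complex.Re (cellint l a) + q * complex.Im (cellint l a).
  have icos := integrable_cell (a := a) (@continuous_cosM R L) (fun x _ => erefl).
  have isin := integrable_cell (a := a) (@continuous_sinM R L) (fun x _ => erefl).
  have mc := @measurable_cell R a.
  rewrite RintegralD //; first by rewrite !RintegralZl.
  - exact: (@integrable_cell _ _ _ _ (pcos p) (fun x _ => erefl)).
  - exact: (@integrable_cell _ _ _ _ (psin q) (fun x _ => erefl)).
have ck (p q : nat -> R) (a : nat) : continuous (fun x => p a * cos (L * x) + q a * sin (L * x)).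
  move=> x; apply: (@continuousD _ _ _ (fun y => p a * cos (L * y))
    (fun y => q a * sin (L * y))); [exact: pcos|exact: psin].
have [|_ reE] := @Rintegral_Omega R A (fun x => u x * cos (L * x) + v x * sin (L * x)) _
    uA (ck (fun a => complex.Re (c a)) (fun a => complex.Im (c a))).
  by move=> a x _ ax; rewrite /u /v !(stepf_cell _ ax).
have [|_ imE] := @Rintegral_Omega R A (fun x => v x * cos (L * x) - u x * sin (L * x)) _
    uA (ck (fun a => complex.Im (c a)) (fun a => - complex.Re (c a))).
  by move=> a x _ ax; rewrite /u /v !(stepf_cell _ ax) mulNr.
rewrite /ip_re /ip_im reE imE.
elim: A {uA u v ck reE imE} => [|a A IH]; first by rewrite !big_nil.
rewrite !big_cons -IH !ipL cellintN.
case: (c a) => p q; case: (cellint l a) => P Q.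
by apply/eqP; rewrite eq_complex /=; apply/andP; split; apply/eqP; ring.
Qed.

(** * From spectra to roots of the mask polynomial *)

(** The matrix of values of the monomials at the points of [s] has more rows than columns, hence a
    nonzero left kernel vector, which supplies the coefficients. *)
Lemma sparse_polynomial_relation (F : fieldType) (A : seq nat) (s : seq F) :
  uniq A -> (size s < size A)%N ->
  exists2 c : nat -> F, (exists2 a, a \in A & c a != 0) &
    forall x, x \in s -> \sum_(a <- A) c a * x ^+ a = 0.
Proof.
move=> uA sA; pose V := \matrix_(i < size A, j < size s) s`_j ^+ nth 0%N A i.
have : kermx V != 0.
  by rewrite -mxrank_eq0 mxrank_ker -lt0n subn_gt0 (leq_ltn_trans (rank_leq_col V)).
move=> /rowV0Pn[r /sub_kermxP rV /rV0Pn[i ri]].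
(* Outside [A] the index is [size A], [insub] fails and the coefficient is 0. *)
pose c a := if insub (index a A) is Some k then r 0 k else 0.
have cE (k : 'I_(size A)) : c (nth 0%N A k) = r 0 k.
  by rewrite /c index_uniq // valK.
exists c; first by exists (nth 0%N A i); rewrite ?mem_nth ?cE.
move=> x xs; have js : (index x s < size s)%N by rewrite index_mem.
have /rowP/(_ (Ordinal js)) := rV; rewrite !mxE => rVj.
rewrite -[RHS]rVj (big_nth 0%N) big_mkord; apply: eq_bigr => k _.
by rewrite cE mxE /= nth_index.
Qed.

(** Otherwise some step function, nonzero on a cell, would be orthogonal to every exponential: its
    inner product with frequency [l] is [cellint (- l) 0] times a sparse polynomial at [cexp (- l)],
    which is chosen to vanish. Completeness forbids this. *)
Lemma exists_new_frequency (R : realType) (A : seq nat) (Lambda : set R) (s : seq R) :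
  uniq A -> spectrum (Omega A) Lambda -> (size s < size A)%N ->
  exists2 l, Lambda l & cexp l \notin map cexp s.
Proof.
move=> uA [_ complete] sA; apply: contrapT => noL.
have inL l : Lambda l -> cexp l \in map cexp s.
  by move=> Ll; apply: contrapT => /negP nl; apply: noL; exists l.
have [|c [a aA ca] c0] := sparse_polynomial_relation (s := [seq cexp (- x) | x <- s]) uA.
  by rewrite size_map.
have [|N [mN N0 subN]] := complete _ _ (L2_stepf (fun a => complex.Re (c a)) uA)
    (L2_stepf (fun a => complex.Im (c a)) uA).
  move=> l /inL/mapP[x xs e].
  have cN : cexp (- l) = cexp (- x) by rewrite -[- l]sub0r -[- x]sub0r !cexpB e.
  have := ip_stepf c l uA => /=.
  under eq_bigr do rewrite cellint_shift mulrA.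
  rewrite -mulr_suml cN c0 ?mul0r; last by apply: map_f.
  by move=> [-> ->].
(* The step function is nonzero on this whole cell, which therefore lies in the null set [N]
   although its measure is 1. *)
have cellN : cell a `<=` N.
  move=> x ax; apply: subN => /(_ (cell_Omega aA ax)).
  rewrite !(stepf_cell _ ax) => -[re0 im0]; move: ca.
  by rewrite eq_complex re0 im0 !eqxx.
suff : (1 <= 0 :> \bar R)%E by rewrite lee_fin ler10.
rewrite -(lebesgue_measure_cell R a) -N0.
exact: (le_measure mu (mem_set (@measurable_cell R a)) (mem_set mN) cellN).
Qed.

(** Starts from [0] and [l] and appends new frequencies at the end, which keeps [0] in first
    position. *)
Lemma exists_frequencies (R : realType) (A : seq nat) (Lambda : set R) (l : R) k :
  uniq A -> spectrum (Omega A) Lambda -> Lambda 0 -> Lambda l -> cexp l != 1 ->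
  (k.+2 <= size A)%N ->
  exists s : seq R, [/\ size s = k.+2, uniq (map cexp s), {in s, forall x, Lambda x},
    s`_0 = 0 & l \in s].
Proof.
move=> uA sp L0 Ll l1; elim: k => [|k IH] kA.
  exists [:: 0; l]; split=> //=; rewrite ?inE ?eqxx ?orbT //.
    by rewrite andbT cexp0 eq_sym.
  by move=> x; rewrite !inE => /orP[] /eqP ->.
have [s [sz us sL s0 ls]] := IH (ltnW kA).
have [x Lx xs] : exists2 x, Lambda x & cexp x \notin map cexp s.
  by apply: exists_new_frequency uA sp _; rewrite sz.
exists (rcons s x); split.
- by rewrite size_rcons sz.
- by rewrite map_rcons rcons_uniq xs.
- by move=> y; rewrite mem_rcons inE => /orP[/eqP ->|/sL].
- by rewrite nth_rcons sz.
- by rewrite mem_rcons inE ls orbT.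
Qed.

(** * The mask polynomial *)

Definition mask_poly (A : seq nat) : {poly int} := \sum_(a <- A) 'X^a.

Lemma coef_mask_poly (A : seq nat) i : uniq A -> (mask_poly A)`_i = (i \in A)%:R.
Proof.
rewrite /mask_poly coef_sum; elim: A => [|a A IH] /=; first by rewrite big_nil.
move=> /andP[aA uA]; rewrite big_cons IH // coefXn inE.
by have [->|] := eqVneq i a; rewrite ?(negPf aA) ?addr0 ?add0r.
Qed.

(** All coefficients are 0 or 1, so the leading one is 1 and its exponent belongs to [A]. *)
Lemma mask_poly_lead (A : seq nat) : uniq A -> (0 < size A)%N ->
  mask_poly A \is monic /\ (size (mask_poly A)).-1 \in A.
Proof.
move=> uA sA; have lead : lead_coef (mask_poly A) != 0.
  rewrite lead_coef_eq0; apply/eqP => /(congr1 (fun p : {poly int} => p`_(nth 0%N A 0))).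
  by rewrite coef_mask_poly // coef0 mem_nth.
move: lead; rewrite monicE lead_coefE coef_mask_poly //.
by case: (_ \in A).
Qed.

Lemma horner_mask_poly (C : numClosedFieldType) (A : seq nat) (x : C) :
  (map_poly intr (mask_poly A)).[x] = \sum_(a <- A) x ^+ a.
Proof.
rewrite rmorph_sum horner_sum; apply: eq_bigr => a _.
by rewrite /= map_polyXn hornerXn.
Qed.

Lemma complex_archi (R : realType) (x : R[i]) : exists n : nat, `|x| <= n%:R.
Proof.
rewrite normc_def; set r := Num.sqrt _.
exists (Num.truncn r).+1; rewrite -(rmorph_nat (real_complex R)) lecR.
by rewrite ltW // truncnS_gt.
Qed.

Lemma mem_bound_Omega (R : realType) (A : seq nat) (M : R) a :
  a \in A -> Omega A `<=` `[0, M] -> a.+1%:R <= M.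
Proof.
move=> aA subM; rewrite leNgt; apply/negP => Ma.
(* If [M < a + 1], this midpoint lies in the cell of [a] and beyond [M]. *)
pose x := (Num.max a%:R M + a.+1%:R) / 2.
have maxa : a%:R <= Num.max a%:R M by rewrite le_max lexx.
have maxM : M <= Num.max a%:R M by rewrite le_max lexx orbT.
have maxlt : Num.max a%:R M < a.+1%:R by rewrite gt_max Ma ltr_nat ltnSn.
have : Omega A x.
  exists a => //; rewrite natr1 /x; move: (a%:R) (a.+1%:R) (Num.max _ _) maxa maxlt => p q m.
  by move=> *; split; lra.
move=> /subM; rewrite /= in_itv /= => /andP[_].
rewrite /x; move: (a.+1%:R) (Num.max _ _) maxM maxlt => q m; lra.
Qed.

(** * Rationality of the spectrum *)

Theorem mainTheorem9 (R : realType) (A : seq nat) (M : R) (Lambda : set R) :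
  uniq A -> (0 \in A)%N -> (2 <= size A)%N ->
  Omega A `<=` `[0, M] ->
  M < 5 * (size A)%:R / 2 ->
  spectrum (Omega A) Lambda ->
  Lambda 0 ->
  forall l, Lambda l -> exists q : rat, l = ratr q.
Proof.
move=> uA A0 sA subM ltM sp L0 l Ll.
(* Integer frequencies are settled at once; any other one differs from 0 modulo 1 and can join it in
   the initial list. *)
have [/cexp_eq1[n ->]|l1] := eqVneq (cexp l) 1; first by exists n%:~R; rewrite ratr_int.
have [s [sz us sL s0 ls]] : exists s : seq R, [/\ size s = size A, uniq (map cexp s),
    {in s, forall x, Lambda x}, s`_0 = 0 & l \in s].
  have := exists_frequencies (k := size A - 2) uA sp L0 Ll l1.
  by rewrite -addn2 subnK //; apply.
have [monF leadF] := mask_poly_lead uA (ltnW sA).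
have F0 : (mask_poly A).[0] != 0 by rewrite horner_coef0 coef_mask_poly // A0.
have F1 : (mask_poly A).[1] != 0.
  rewrite horner_sum; under eq_bigr do rewrite hornerXn expr1n.
  by rewrite big_const_seq count_predT iter_addr_0 pnatr_eq0 -lt0n ltnW.
(* The degree of the mask polynomial is an element of [A], so its size, one more, is at most [M]. *)
have szF : (2 * size (mask_poly A) < 5 * size A)%N.
  have := le_lt_trans (mem_bound_Omega leadF subM) ltM.
  rewrite prednK ?size_poly_gt0 ?monic_neq0 // ltr_pdivlMr // mulrC.
  by rewrite -!natrM ltr_nat.
pose z (i : 'I_(size A)) := cexp s`_i.
have Fz j k : j != k -> root (map_poly intr (mask_poly A)) (z j / z k).
  move=> jk; rewrite /root horner_mask_poly -cexpB.
  have ne : z j != z k.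
    have := nth_uniq 0 _ _ us; rewrite size_map sz => /(_ j k (ltn_ord j) (ltn_ord k)).
    by rewrite !(nth_map 0) ?sz // => ->.
  have sjk : s`_j <> s`_k by move=> e; move: ne; rewrite /z e eqxx.
  have sin_ i : Lambda s`_(i : 'I_(size A)) by apply: sL; rewrite mem_nth ?sz.
  have [c0 s0'] := sp.1 _ _ (sin_ j) (sin_ k) sjk.
  apply/eqP/sum_cexp_eq0 => //.
  apply: contra ne => /eqP; rewrite cexpB => /(congr1 ( *%R^~ (cexp s`_k))).
  by rewrite divfK ?cexp_neq0 // mul1r => /eqP.
have i0P : (0 < size A)%N := ltnW sA.
have li : (index l s < size A)%N by rewrite -sz index_mem.
have [t t0] := @short_spectrum_torsion _ _ _ z (Ordinal i0P) (@complex_archi R) monF F0 F1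
  (fun j => norm_cexp _) (etrans (congr1 cexp s0) (cexp0 R)) Fz szF (Ordinal li).
(* From [cexp l ^+ t = 1] it follows that [l * t] is an integer [n]. *)
rewrite /z /= nth_index // -cexpMn => /cexp_eq1[n e].
exists (n%:~R / t%:R); rewrite fmorph_div /= ratr_int ratr_nat -e mulfK //.
by rewrite pnatr_eq0 -lt0n.
Qed.
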